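(* Let $h$ be a Koebe isothermic net and, for $\varphi\in\mathbb S^1$, let $h^\varphi$ be a member of the associated family of $h^*$ (the Christoffel dual discrete maximal surface), with oriented timelike spheres $h_\circ^\varphi$ at the white vertices. Then there are two contact congruences $(c^1)^\varphi$ and $(c^2)^\varphi$ whose restrictions to the white vertices satisfy $(c^1_\circ)^\varphi=(c^2_\circ)^\varphi=h_\circ^\varphi$.
   Context: **Lorentz sphere geometry.** $\mathbb R^{2,1}$ is $\mathbb R^3$ with $\langle x,y\rangle=x_1y_1+x_2y_2-x_3y_3$; $|x|=\sqrt{\langle x,x\rangle}$ for spacelike $x$. The Lorentz cross product is defined by $\langle x\times y,z\rangle=\det(x,y,z)$. $\mathbf U_+=\{x:\langle x,x\rangle=-1,\ x_3>0\}$. An oriented sphere has a centre $m$ and a signed radius $R\in\mathbb R$ and underlying set $\{x:\langle x-m,x-m\rangle=R^2\}$; it is an oriented timelike sphere if $R\ne0$ and a null-sphere (with apex $m$) if $R=0$. An oriented isotropic line is a line $\{p+sv\}$ with $\langle v,v\rangle=0$, $v\neq0$, together with an orientation of the direction $v=(v',v_3)$; let $\nu=(Jv'/|v'|,0)$ with $J$ the rotation of $\mathbb R^2$ by $\pi/2$. The oriented sphere $(m,R)$ is in oriented contact with this line if $p-m\in R\nu+\mathbb Rv$; for $R\neq 0$ this means that the line is contained in the sphere with compatible orientation, for $R=0$ that it passes through the apex. Two oriented timelike spheres $(m,R),(m',R')$ are in oriented contact if they touch and $\langle m-m',m-m'\rangle=(R-R')^2$. A spacelike circle is the intersection of a sphere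 with a spacelike plane. **Combinatorics.** $\mathbb Z^2$ is bipartitioned into black vertices $\mathbb Z^2_\bullet$ ($z_1+z_2$ even) and white vertices $\mathbb Z^2_\circ$ ($z_1+z_2$ odd). Each face of $\mathbb Z^2$ has two white and two black vertices; two white vertices of a common face are called adjacent. White edges in direction $(1,1)$ are called horizontal, those in direction $(1,-1)$ vertical. **Contact congruence.** A contact congruence $c$ assigns to each vertex $v\in\mathbb Z^2$ an oriented timelike sphere or a null-sphere $c(v)$ and to each face $f$ of $\mathbb Z^2$ an oriented isotropic line $c(f)$, such that $c(v)$ is in oriented contact with $c(f)$ whenever $v$ and $f$ are incident. $c_\circ$ is the restriction to white vertices. **S-isothermic and Koebe isothermic nets.** A (spacelike Lorentz) S-isothermic net $h$ assigns to each white vertex $w$ an oriented timelike sphere $h(w)$, to each black vertex $b$ a spacelike circle $h(b)$, and to each face $f$ a point $h(f)$, such that for all faces $f=(w,b,w',b')$ the spheres $h(w),h(w')$ are in oriented contact and the circles $h(b),h(b')$ intersect the two spheres orthogonally in the point $h(f)$. ${\odot h}_\circ(w)$ denotes the centre of $h(w)$. It is a Koebe isothermic net if all circles $h(b)$ lie in $\mathbf U_+$; equivalently, it arises from an orthogonal circle pattern of spacelike circles on $\mathbf U_+$ (a circle at each vertex of $\mathbb Z^2$, adjacent circles orthogonal, the four circles around each face meeting in a point), $h(b)$ being the black circle and $h(w)$ the timelike sphere meeting $\mathbf U_+$ orthogonally in the white circle. $R(w)>0$ denotes the (unsigned) radius of $h(w)$; for adjacent $w,w'$ sharing the face $f$ the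 point $h(f)\in\mathbf U_+$ lies between the centres, so $|{\odot h}_\circ(w')-{\odot h}_\circ(w)|=R(w)+R(w')$. **Associated family.** For a face $f$ with white vertices $w,w'$ let $N=h(f)$, $T=({\odot h}_\circ(w')-{\odot h}_\circ(w))/|{\odot h}_\circ(w')-{\odot h}_\circ(w)|$ and $T^\varphi=T\cos\varphi+(T\times N)\sin\varphi$. The net ${\odot h}_\circ^\varphi:\mathbb Z^2_\circ\to\mathbb R^{2,1}$ is defined up to translation by $${\odot h}_\circ^\varphi(w')-{\odot h}_\circ^\varphi(w)=\pm\big(R(w)^{-1}+R(w')^{-1}\big)T^\varphi$$ with $+$ for horizontal and $-$ for vertical white edges (these increments are consistent around every black vertex). For $\varphi=0$ this gives the sphere centres of the Christoffel dual $h^*$. The spheres $h_\circ^\varphi(w)$ are the timelike spheres with centres ${\odot h}_\circ^\varphi(w)$ and radii $R(w)^{-1}$; spheres at adjacent white vertices touch, and they are oriented such that spheres at adjacent white vertices are in oriented contact (the orientation of one initial sphere is free). $h^\varphi$ is the corresponding member of the associated family of $h^*$. The congruences $(c^1)^\varphi,(c^2)^\varphi$ of the claim are called associated congruences. *)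

(* Defs.v *)
From HB Require Import structures.
From mathcomp Require Import all_boot all_order all_algebra.
From mathcomp Require Import reals trigo.
From mathcomp Require Import ring.

Set Implicit Arguments.
Unset Strict Implicit.
Unset Printing Implicit Defensive.

Import Order.TTheory GRing.Theory Num.Theory.
Local Open Scope ring_scope.

(** * The Lorentz space R^{2,1} *)

(* Coordinates x_1, x_2, x_3 of the text are x 0 0, x 0 1, x 0 2. *)
Definition vec (R : realType) := 'rV[R]_3.

Definition vec3 (R : realType) (a b c : R) : vec R :=
  \row_(i < 3) [:: a; b; c]`_i.

Definition ldot (R : realType) (x y : vec R) : R :=
  x 0 0 * y 0 0 + x 0 1 * y 0 1 - x 0 2 * y 0 2.

(* Only meaningful for spacelike x: Num.sqrt is 0 on negative reals. *)
Definition lnorm (R : realType) (x : vec R) : R := Num.sqrt (ldot x x).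

Definition lcross (R : realType) (x y : vec R) : vec R :=
  vec3 (x 0 1 * y 0 2 - x 0 2 * y 0 1)
       (x 0 2 * y 0 0 - x 0 0 * y 0 2)
       (x 0 1 * y 0 0 - x 0 0 * y 0 1).

Lemma ldot_lcross (R : realType) (x y z : vec R) :
  ldot (lcross x y) z = \det (\matrix_(i < 3) [:: x; y; z]`_i).
Proof.
rewrite (expand_det_row _ 0) !big_ord_recl big_ord0 /cofactor.
rewrite !(expand_det_row _ 0) !big_ord_recl !big_ord0 /cofactor !det_mx11.
rewrite /ldot /lcross !mxE /=.
have [f fE] : exists f : vec R -> nat -> R,
    forall (u : vec R) (i : 'I_3), u 0 i = f u (val i).
  by exists (fun u k => u 0 (inord k)) => u i; rewrite inord_val.
by rewrite !fE /= /bump /=; ring.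
Qed.

Definition upper_hyperboloid (R : realType) (x : vec R) : Prop :=
  ldot x x = -1 /\ 0 < x 0 2.

(** * Oriented spheres, isotropic lines, spacelike circles *)

Record osphere (R : realType) := OSphere { center : vec R; radius : R }.

Definition on_sphere (R : realType) (S : osphere R) (x : vec R) : Prop :=
  ldot (x - center S) (x - center S) = radius S ^+ 2.

Definition timelike_sphere (R : realType) (S : osphere R) : Prop :=
  radius S != 0.

Definition sphere_tangent (R : realType) (S : osphere R) (p u : vec R) : Prop :=
  ldot u (p - center S) = 0.

Definition touch (R : realType) (S S' : osphere R) : Prop :=
  exists p : vec R,
    [/\ on_sphere S p, on_sphere S' p &
        forall u : vec R, sphere_tangent S p u <-> sphere_tangent S' p u].

Definition oriented_contact (R : realType) (S S' : osphere R) : Prop :=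
  [/\ timelike_sphere S, timelike_sphere S', touch S S' &
      ldot (center S - center S') (center S - center S')
      = (radius S - radius S') ^+ 2].

(* The line { p + s v } oriented by v.  Different (p, v) may represent the same
   oriented line, see [same_oline]. *)
Record oline (R : realType) := OLine {
  line_pt : vec R;
  line_dir : vec R;
  line_isotropic : ldot line_dir line_dir = 0;
  line_dir_neq0 : line_dir != 0 }.

Definition same_oline (R : realType) (l l' : oline R) : Prop :=
  (exists2 a : R, 0 < a & line_dir l' = a *: line_dir l) /\
  (exists s : R, line_pt l' - line_pt l = s *: line_dir l).

(* nu = (J v' / |v'|, 0) for v = (v', v_3), where J (a, b) = (- b, a). *)
Definition line_nu (R : realType) (v : vec R) : vec R :=
  let r := Num.sqrt (v 0 0 ^+ 2 + v 0 1 ^+ 2) in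
  vec3 (- v 0 1 / r) (v 0 0 / r) 0.

Definition line_contact (R : realType) (S : osphere R) (l : oline R) : Prop :=
  exists s : R,
    line_pt l - center S
    = radius S *: line_nu (line_dir l) + s *: line_dir l.

(* The intersection of a sphere with the plane { x | <x, n> = d }, which is
   spacelike since its normal n is timelike.  Empty intersections and single
   points are excluded by [circle_proper]. *)
Record spacelike_circle (R : realType) := SpacelikeCircle {
  circle_sphere : osphere R;
  circle_normal : vec R;
  circle_offset : R;
  circle_spacelike : ldot circle_normal circle_normal < 0;
  circle_proper : exists x y : vec R,
    [/\ x != y, on_sphere circle_sphere x, on_sphere circle_sphere y,
        ldot x circle_normal = circle_offset &
        ldot y circle_normal = circle_offset] }.

Definition on_circle (R : realType) (C : spacelike_circle R) (x : vec R) :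
    Prop :=
  on_sphere (circle_sphere C) x /\ ldot x (circle_normal C) = circle_offset C.

Definition circle_tangent (R : realType) (C : spacelike_circle R)
    (p t : vec R) : Prop :=
  sphere_tangent (circle_sphere C) p t /\ ldot t (circle_normal C) = 0.

Definition meets_orthogonally (R : realType) (C : spacelike_circle R)
    (S : osphere R) (p : vec R) : Prop :=
  [/\ on_circle C p, on_sphere S p &
      forall t u : vec R,
        circle_tangent C p t -> sphere_tangent S p u -> ldot t u = 0].

(** * Combinatorics of Z^2 *)

Definition vertex := (int * int)%type.

Definition white (z : vertex) : bool := ~~ (2 %| z.1 + z.2)%Z.
Definition black (z : vertex) : bool := (2 %| z.1 + z.2)%Z.

(* The face (i, j) is the unit square with lower left corner (i, j). *)
Definition face := (int * int)%type.

Definition incident (v : vertex) (f : face) : bool :=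
  ((v.1 == f.1) || (v.1 == f.1 + 1)) && ((v.2 == f.2) || (v.2 == f.2 + 1)).

Definition white_edge (f : face) (w w' : vertex) : bool :=
  [&& white w, white w', incident w f, incident w' f & w != w'].

(* For a white edge w w': direction +-(1, 1) rather than +-(1, -1). *)
Definition horizontal (w w' : vertex) : bool :=
  w'.1 - w.1 == w'.2 - w.2.

(** * Contact congruences *)

Record contact_congruence (R : realType) := ContactCongruence {
  cc_sphere : vertex -> osphere R;
  cc_line : face -> oline R;
  cc_contact : forall (v : vertex) (f : face),
    incident v f -> line_contact (cc_sphere v) (cc_line f) }.

Definition same_congruence (R : realType) (c c' : contact_congruence R) :
    Prop :=
  (forall v : vertex, cc_sphere c v = cc_sphere c' v) /\
  (forall f : face, same_oline (cc_line c f) (cc_line c' f)).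

(** * S-isothermic and Koebe isothermic nets *)

(* Only the values of [net_sphere] at white vertices and of [net_circle] at
   black vertices are part of the net; the other values are irrelevant. *)
Record net (R : realType) := Net {
  net_sphere : vertex -> osphere R;
  net_circle : vertex -> spacelike_circle R;
  net_pt : face -> vec R }.

Definition s_isothermic (R : realType) (h : net R) : Prop :=
  [/\ forall w : vertex, white w -> timelike_sphere (net_sphere h w),
      forall (f : face) (w w' : vertex), white_edge f w w' ->
        oriented_contact (net_sphere h w) (net_sphere h w') &
      forall (f : face) (w b : vertex),
        white w -> black b -> incident w f -> incident b f ->
        meets_orthogonally (net_circle h b) (net_sphere h w) (net_pt h f)].

Definition between (R : realType) (p x y : vec R) : Prop :=
  exists t : R, [/\ 0 < t, t < 1 & p = (1 - t) *: x + t *: y].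

(* The last clause is the standing convention that tangent spheres touch
   externally; the other clauses alone would also admit nested spheres, for
   which |m' - m| = R(w) + R(w') fails. *)
Definition koebe_isothermic (R : realType) (h : net R) : Prop :=
  [/\ s_isothermic h,
      forall b : vertex, black b ->
        forall x : vec R, on_circle (net_circle h b) x ->
          upper_hyperboloid x &
      forall (f : face) (w w' : vertex), white_edge f w w' ->
        between (net_pt h f)
          (center (net_sphere h w)) (center (net_sphere h w'))].

Definition net_radius (R : realType) (h : net R) (w : vertex) : R :=
  `|radius (net_sphere h w)|.

(** * The associated family *)

Definition edge_tangent (R : realType) (h : net R) (w w' : vertex) : vec R :=
  let e := center (net_sphere h w') - center (net_sphere h w) in
  (lnorm e)^-1 *: e.

Definition rotated_tangent (R : realType) (h : net R) (phi : R)
    (f : face) (w w' : vertex) : vec R :=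
  let T := edge_tangent h w w' in
  cos phi *: T + sin phi *: lcross T (net_pt h f).

(* [s] is one of the choices of the oriented spheres at the white vertices of
   the member h^phi: it is determined by [h] and [phi] up to a translation and
   up to a simultaneous change of all orientations. *)
Definition associated_spheres (R : realType) (h : net R) (phi : R)
    (s : vertex -> osphere R) : Prop :=
  [/\ forall (f : face) (w w' : vertex), white_edge f w w' ->
        center (s w') - center (s w)
        = ((if horizontal w w' then 1 else -1)
           * ((net_radius h w)^-1 + (net_radius h w')^-1))
          *: rotated_tangent h phi f w w',
      forall w : vertex, white w -> `|radius (s w)| = (net_radius h w)^-1 &
      forall (f : face) (w w' : vertex), white_edge f w w' ->
        oriented_contact (s w) (s w')].

(* Main.v *)
Require Import Defs.
From mathcomp Require Import all_boot all_order all_algebra.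
From mathcomp Require Import boolp reals trigo.
From mathcomp Require Import ring lra zify.

Set Implicit Arguments.
Unset Strict Implicit.
Unset Printing Implicit Defensive.

Import Order.TTheory GRing.Theory Num.Theory.
Local Open Scope ring_scope.

(* An oriented sphere (m, r) is a point of R^{2,2}, i.e. of the 2x2 matrices with
   the determinant as quadratic form. The oriented isotropic lines are the
   totally isotropic planes; the future directed lines form one family of such
   planes and the past directed ones the other. Spheres in oriented contact
   differ by a rank one matrix, so they lie in exactly one common plane of each
   family. Choose a future directed line at the faces with a horizontal white
   edge and a past directed one at the others, or vice versa: this gives the two
   congruences. Around a black vertex the four planes alternate between the two
   families. If two opposite planes have distinct kernels, they meet in a single
   point, which then automatically lies on the other two planes, because planes
   of different families through a common point meet in a line.

   It remains to exclude that both pairs of opposite planes have a common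
   kernel. The touching points N_i around a black vertex lie on a circle of the
   hyperboloid, and the rotated tangents T_i^phi are images of one vector under
   the rotations about the axis of the circle, up to sign. Opposite planes with
   a common kernel force the corresponding N_i to agree, or the T_i to run
   through the circle in opposite directions. This is excluded by the position
   of the sphere centres on the tangents of the circle and by the closing
   condition of the associated net around the black vertex. *)

(** * Lorentz vector algebra *)

Lemma vec_ext (R : realType) (x y : vec R) :
  x 0 0 = y 0 0 -> x 0 1 = y 0 1 -> x 0 2 = y 0 2 -> x = y.
Proof.
move=> e0 e1 e2; apply/rowP => i.
case: i => [[|[|[|//]]] lti] //.
- by rewrite (_ : Ordinal lti = 0) //; apply: val_inj.
- by rewrite (_ : Ordinal lti = 1) //; apply: val_inj.
- by rewrite (_ : Ordinal lti = 2) //; apply: val_inj.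
Qed.

Lemma vec3E (R : realType) (a b c : R) :
  ((vec3 a b c 0 0 = a) * (vec3 a b c 0 1 = b) * (vec3 a b c 0 2 = c))%type.
Proof. by rewrite /vec3 !mxE. Qed.

(* [ring] mistakes the coercion [fun_of_matrix] for a morphism to be pushed
   through, hence the generalization of all coordinates. *)
Ltac coords := rewrite /ldot /lcross; do ?rewrite !(vec3E, mxE);
  repeat match goal with
  | |- context [fun_of_matrix ?x ?i ?j] =>
    let a := fresh "a" in move: (fun_of_matrix x i j) => a
  end.

Lemma ldotC (R : realType) (x y : vec R) : ldot x y = ldot y x.
Proof. by coords; ring. Qed.
Lemma ldotDl (R : realType) (x y z : vec R) :
  ldot (x + y) z = ldot x z + ldot y z.
Proof. by coords; ring. Qed.
Lemma ldotBl (R : realType) (x y z : vec R) :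
  ldot (x - y) z = ldot x z - ldot y z.
Proof. by coords; ring. Qed.
Lemma ldotZl (R : realType) (a : R) (x y : vec R) :
  ldot (a *: x) y = a * ldot x y.
Proof. by coords; ring. Qed.
Lemma ldotDr (R : realType) (x y z : vec R) :
  ldot z (x + y) = ldot z x + ldot z y.
Proof. by coords; ring. Qed.
Lemma ldotBr (R : realType) (x y z : vec R) :
  ldot z (x - y) = ldot z x - ldot z y.
Proof. by coords; ring. Qed.
Lemma ldotZr (R : realType) (a : R) (x y : vec R) :
  ldot x (a *: y) = a * ldot x y.
Proof. by coords; ring. Qed.
Definition ldotE := (ldotBl, ldotBr, ldotDl, ldotDr, ldotZl, ldotZr).

Lemma lcrossBl (R : realType) (x y z : vec R) :
  lcross (x - y) z = lcross x z - lcross y z.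
Proof. by apply: vec_ext; coords; ring. Qed.
Lemma lcrossZl (R : realType) (a : R) (x y : vec R) :
  lcross (a *: x) y = a *: lcross x y.
Proof. by apply: vec_ext; coords; ring. Qed.

Lemma ldot_crossl (R : realType) (x y : vec R) : ldot (lcross x y) x = 0.
Proof. by coords; ring. Qed.
Lemma ldot_crossr (R : realType) (x y : vec R) : ldot (lcross x y) y = 0.
Proof. by coords; ring. Qed.

Lemma ldot_cross_cross (R : realType) (x y : vec R) :
  ldot (lcross x y) (lcross x y) = ldot x y ^+ 2 - ldot x x * ldot y y.
Proof. by coords; ring. Qed.

Lemma lcross_cross (R : realType) (x y z : vec R) :
  lcross x (lcross y z) = ldot x y *: z - ldot x z *: y.
Proof. by apply: vec_ext; coords; ring. Qed.

(* Cauchy-Schwarz in the first two coordinates: the orthogonal complement of a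
   timelike vector is positive definite. *)
Lemma timelike_orth_ge0 (R : realType) (c D : vec R) :
  ldot c c < 0 -> ldot D c = 0 -> 0 <= ldot D D.
Proof.
rewrite /ldot; move: (c 0 0) (c 0 1) (c 0 2) (D 0 0) (D 0 1) (D 0 2).
move=> c0 c1 c2 d0 d1 d2 cc dc.
have c2p : 0 < c2 ^+ 2 by nra.
rewrite -(pmulr_rge0 _ c2p).
have -> : c2 ^+ 2 * (d0 * d0 + d1 * d1 - d2 * d2) =
  (d0 ^+ 2 + d1 ^+ 2) * (c2 ^+ 2 - c0 ^+ 2 - c1 ^+ 2)
  + (d0 * c1 - d1 * c0) ^+ 2
  + (d0 * c0 + d1 * c1 - d2 * c2) * (d0 * c0 + d1 * c1 + d2 * c2) by ring.
by rewrite dc mul0r addr0 addr_ge0 ?sqr_ge0// mulr_ge0; nra.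
Qed.

Lemma timelike_orth_eq0 (R : realType) (c D : vec R) :
  ldot c c < 0 -> ldot D c = 0 -> ldot D D = 0 -> D = 0.
Proof.
move=> cc dc dd.
have [e0 e1 e2] : [/\ D 0 0 = 0, D 0 1 = 0 & D 0 2 = 0].
  move: cc dc dd.
  rewrite /ldot; move: (c 0 0) (c 0 1) (c 0 2) (D 0 0) (D 0 1) (D 0 2).
  move=> c0 c1 c2 d0 d1 d2 cc dc dd.
  have q0 : (d0 ^+ 2 + d1 ^+ 2) * (c2 ^+ 2 - c0 ^+ 2 - c1 ^+ 2)
      + (d0 * c1 - d1 * c0) ^+ 2 = 0.
    have -> : (d0 ^+ 2 + d1 ^+ 2) * (c2 ^+ 2 - c0 ^+ 2 - c1 ^+ 2)
        + (d0 * c1 - d1 * c0) ^+ 2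
      = c2 ^+ 2 * (d0 * d0 + d1 * d1 - d2 * d2)
        - (d0 * c0 + d1 * c1 - d2 * c2) * (d0 * c0 + d1 * c1 + d2 * c2) by ring.
    by rewrite dc dd; ring.
  have dd' : d0 ^+ 2 + d1 ^+ 2 = 0.
    have h1 : 0 < c2 ^+ 2 - c0 ^+ 2 - c1 ^+ 2 by lra.
    have h2 := sqr_ge0 (d0 * c1 - d1 * c0).
    have h3 : 0 <= d0 ^+ 2 + d1 ^+ 2 by rewrite addr_ge0 ?sqr_ge0.
    nra.
  have h0 := sqr_ge0 d0; have h1 := sqr_ge0 d1.
  by split; apply/eqP; rewrite -sqrf_eq0; apply/eqP; lra.
by apply: vec_ext; rewrite mxE.
Qed.

Lemma timelike_orth_gt0 (R : realType) (c D : vec R) :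
  ldot c c < 0 -> ldot D c = 0 -> D != 0 -> 0 < ldot D D.
Proof.
move=> cc dc D0; rewrite lt_def (timelike_orth_ge0 cc dc) andbT.
by apply: contra_neq D0 => /(timelike_orth_eq0 cc dc).
Qed.

Lemma cramer_vec (R : realType) (x y z w : vec R) :
  ldot (lcross x y) z *: w =
  ldot w x *: lcross y z + ldot w y *: lcross z x + ldot w z *: lcross x y.
Proof. by apply: vec_ext; coords; ring. Qed.

(** * Tangents of a circle of the hyperboloid *)

(* N is a point of a spacelike circle of the hyperboloid with axis c in the
   plane <x, c> = d, and T is a unit tangent of the circle at N; the sign of b
   tells the direction in which T runs through the circle. *)
Definition circle_frame (R : realType) (c : vec R) (d : R) (N T : vec R)
    (b : R) : Prop :=
  [/\ ldot N c = d, ldot T T = 1, b *: T = lcross N c,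
      b *: lcross T N = c + d *: N & b ^+ 2 = d ^+ 2 + ldot c c].

(** Cramer's rule for T, N, c leaves only the term along [lcross N c]; crossing this relation with N
    and squaring it give the last two. *)
Lemma circle_frameP (R : realType) (c N T : vec R) :
  ldot N N = -1 -> ldot T T = 1 -> ldot T N = 0 -> ldot T c = 0 ->
  circle_frame c (ldot N c) N T (ldot (lcross T N) c).
Proof.
move=> NN TT TN Tc; set b := ldot (lcross T N) c.
have bT : b *: T = lcross N c.
  by rewrite /b cramer_vec TT TN Tc !scale0r !addr0 scale1r.
split=> //.
  have lcN : lcross (lcross N c) N = - lcross N (lcross N c).
    by apply: vec_ext; coords; ring.
  rewrite -lcrossZl bT lcN lcross_cross NN scaleN1r.
  by rewrite opprB opprK addrC.
have : ldot (b *: T) (b *: T) = ldot (lcross N c) (lcross N c) by rewrite bT.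
by rewrite !ldotE TT mulr1 ldot_cross_cross NN -expr2 mulN1r opprK.
Qed.

Definition rot_tangent (R : realType) (phi : R) (N T : vec R) : vec R :=
  cos phi *: T + sin phi *: lcross T N.

Lemma ldot_rot_tangent (R : realType) (phi : R) (N T : vec R) :
  ldot N N = -1 -> ldot T T = 1 -> ldot T N = 0 ->
  ldot (rot_tangent phi N T) (rot_tangent phi N T) = 1.
Proof.
move=> NN TT TN; rewrite /rot_tangent !ldotE ldot_cross_cross NN TT TN.
rewrite (ldotC T) ldot_crossl -[RHS](cos2Dsin2 phi).
by ring.
Qed.

Lemma rot_tangentN (R : realType) (phi : R) (N T : vec R) :
  rot_tangent phi N (- T) = - rot_tangent phi N T.
Proof.
by rewrite /rot_tangent -!scaleN1r lcrossZl scalerDr !scalerA ![_ * -1]mulrC.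
Qed.

(* On a circle the rotated tangents are the images of one vector under the
   rotations about the axis, and differ by a null vector only if equal. *)
Lemma rot_tangent_null_inj (R : realType) (phi : R) (c : vec R) (d b : R)
    (N T N' T' : vec R) :
  ldot c c < 0 -> b != 0 ->
  circle_frame c d N T b -> circle_frame c d N' T' b ->
  let D := rot_tangent phi N T - rot_tangent phi N' T' in
  ldot D D = 0 -> N = N'.
Proof.
move=> cc b0 [Nc _ bT bTN b2] [N'c _ bT' bTN' _] D DD.
apply/eqP; rewrite -subr_eq0; apply/eqP.
set E := N - N'.
have Ec : ldot E c = 0 by rewrite ldotBl Nc N'c subrr.
apply: (timelike_orth_eq0 cc Ec).
(* The frame relations make b D a linear image of E alone. *)
have bD : b *: D = cos phi *: lcross E c + (sin phi * d) *: E.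
  rewrite /D /E /rot_tangent scalerBr !scalerDr.
  rewrite ![b *: (_ *: _)]scalerA ![b * _]mulrC -!scalerA bT bT' bTN bTN'.
  by apply: vec_ext; coords; ring.
clearbody D E.
have : ldot (b *: D) (b *: D) = 0 by rewrite !ldotE DD !mulr0.
rewrite bD !ldotE ldot_cross_cross Ec (ldotC E) ldot_crossl => H.
have : (cos phi ^+ 2 * - ldot c c + sin phi ^+ 2 * d ^+ 2) * ldot E E = 0.
  by rewrite -[RHS]H; ring.
move/eqP; rewrite mulf_eq0 => /orP[|/eqP//].
(* As b ^+ 2 >= 0, d ^+ 2 is at least - <c, c> > 0, so the bracket is positive. *)
have dp : - ldot c c <= d ^+ 2 by have := sqr_ge0 b; lra.
have := cos2Dsin2 phi => cs /eqP H'.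
have := sqr_ge0 (sin phi); nra.
Qed.

(** The frames give b (T + T') = - (N' - N) x c, so b (N' - N) is a multiple of a vector orthogonal
    to N' - N, and the complement of the axis is definite. *)
Lemma frame_flip (R : realType) (c : vec R) (d b k : R)
    (N T N' T' : vec R) :
  ldot c c < 0 -> b != 0 ->
  circle_frame c d N T b -> circle_frame c d N' T' (- b) ->
  N' - N = k *: (T + T') -> N' = N /\ T' = - T.
Proof.
move=> cc b0 [Nc _ bT _ _] [N'c _ bT' _ _] DE.
have NN' : N' = N.
  apply/eqP; rewrite -subr_eq0; apply/eqP.
  have Dc : ldot (N' - N) c = 0 by rewrite ldotBl Nc N'c subrr.
  apply: (timelike_orth_eq0 cc Dc).
  apply: (mulfI b0); rewrite mulr0 -ldotZl.
  have -> : b *: (N' - N) = (- k) *: lcross (N' - N) c.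
    rewrite {1}DE scalerA mulrC -scalerA scalerDr bT.
    rewrite -[b]opprK scaleNr bT' lcrossBl.
    by apply: vec_ext; coords; ring.
  by rewrite ldotZl ldot_crossl mulr0.
split=> //; apply: (scalerI b0); rewrite scalerN bT.
by rewrite -[b]opprK scaleNr bT' NN'.
Qed.

Lemma frame_same (R : realType) (c : vec R) (d b : R) (N T T' : vec R) :
  b != 0 -> circle_frame c d N T b -> circle_frame c d N T' b -> T = T'.
Proof.
by move=> b0 [_ _ bT _ _] [_ _ bT' _ _]; apply: (scalerI b0); rewrite bT bT'.
Qed.

(** * Chains of touching points around a black vertex *)

Lemma unit_neq0 (R : realType) (x : vec R) : ldot x x = 1 -> x <> 0.
Proof.
by move=> xx x0; move: xx; rewrite x0; coords; rewrite !mulr0 !addr0 subr0;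
  apply/eqP; rewrite eq_sym oner_eq0.
Qed.

(* The four touching points N_i around a black vertex and the unit tangents T_i
   there; the centre of the i-th white sphere is N_(i-1) + r_i T_(i-1)
   = N_i - r_i T_i. *)
Definition tangent_chain (R : realType) (c : vec R) (d phi : R)
    (N1 N2 N3 N4 T1 T2 T3 T4 : vec R) (b1 b2 b3 b4 : R) : Prop :=
  [/\ ldot c c < 0,
      [/\ b1 != 0, b2 ^+ 2 = b1 ^+ 2, b3 ^+ 2 = b1 ^+ 2 & b4 ^+ 2 = b1 ^+ 2],
      [/\ circle_frame c d N1 T1 b1, circle_frame c d N2 T2 b2,
          circle_frame c d N3 T3 b3 & circle_frame c d N4 T4 b4],
      exists r : R * R * R * R,
        [/\ [/\ 0 < r.1.1.1, 0 < r.1.1.2, 0 < r.1.2 & 0 < r.2],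
            N2 - N1 = r.1.1.1 *: (T1 + T2), N3 - N2 = r.1.1.2 *: (T2 + T3),
            N4 - N3 = r.1.2 *: (T3 + T4) & N1 - N4 = r.2 *: (T4 + T1)] &
      exists a : R * R * R * R,
        [/\ [/\ 0 < a.1.1.1, 0 < a.1.1.2, 0 < a.1.2 & 0 < a.2],
            [/\ ldot (rot_tangent phi N1 T1) (rot_tangent phi N1 T1) = 1,
                ldot (rot_tangent phi N2 T2) (rot_tangent phi N2 T2) = 1,
                ldot (rot_tangent phi N3 T3) (rot_tangent phi N3 T3) = 1 &
                ldot (rot_tangent phi N4 T4) (rot_tangent phi N4 T4) = 1] &
            a.1.1.1 *: rot_tangent phi N1 T1 - a.1.1.2 *: rot_tangent phi N2 T2
            + a.1.2 *: rot_tangent phi N3 T3 - a.2 *: rot_tangent phi N4 T4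
            = 0]].

(** The cyclic shift only changes the sign of the closing sum. *)
Lemma tangent_chain_rot (R : realType) (c : vec R) (d phi : R)
    (N1 N2 N3 N4 T1 T2 T3 T4 : vec R) (b1 b2 b3 b4 : R) :
  tangent_chain c d phi N1 N2 N3 N4 T1 T2 T3 T4 b1 b2 b3 b4 ->
  tangent_chain c d phi N2 N3 N4 N1 T2 T3 T4 T1 b2 b3 b4 b1.
Proof.
case=> cc [b0 e2 e3 e4] [f1 f2 f3 f4] [r [[? ? ? ?] ? ? ? ?]].
move=> [a [[? ? ? ?] [? ? ? ?] cl]].
split=> //.
- by split; rewrite ?e2 // -sqrf_eq0 e2 sqrf_eq0.
- by exists (r.1.1.2, r.1.2, r.2, r.1.1.1).
exists (a.1.1.2, a.1.2, a.2, a.1.1.1); split=> //=.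
by rewrite -oppr0 -cl; apply: vec_ext; coords; ring.
Qed.

(** If N1 = N3, then T1 = T3, and adding neighbouring relations gives N2 = N4 = N1 and T2 = T4 = -
    T1. The closing sum is then a positive multiple of a unit vector. *)
Lemma chain_opposite_neq (R : realType) (c : vec R) (d phi : R)
    (N1 N2 N3 N4 T1 T2 T3 T4 : vec R) (b1 b2 b3 b4 : R) :
  tangent_chain c d phi N1 N2 N3 N4 T1 T2 T3 T4 b1 b2 b3 b4 ->
  b1 = b3 -> N1 <> N3.
Proof.
case=> cc [b0 e2 e3 e4] [f1 f2 f3 f4] [[[[r1 r2] r3] r4] /=
  [[? ? ? ?] d1 d2 d3 d4]].
move=> [[[[a1 a2] a3] a4] /= [[? ? ? ?] [u1 _ _ _] cl]] b13 N13; subst b3 N3.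
have T13 := frame_same b0 f1 f3; subst T3.
have aux (u v : R) (T N : vec R) : 0 < u -> 0 < v ->
    N - N1 = u *: (T1 + T) -> N1 - N = v *: (T + T1) -> N = N1 /\ T = - T1.
  move=> u0 v0 du dv; have uv : u + v != 0 by rewrite gt_eqF ?addr_gt0.
  have TT : T = - T1.
    apply/eqP; rewrite -addr_eq0; apply/eqP.
    apply: (scalerI uv); rewrite scaler0 scalerDl -dv.
    by rewrite [T + T1]addrC -du -(opprB N1 N) addNr.
  split=> //; apply/eqP; rewrite -subr_eq0 du TT subrr scaler0.
  by rewrite eqxx.
have [//|//|N2E T2E] := aux r1 r2 T2 N2 _ _ d1 d2.
have [//|//|N4E T4E] := aux r3 r4 T4 N4 _ _ d3 d4.
move: cl; rewrite N2E T2E N4E T4E !rot_tangentN.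
rewrite !scalerN !opprK -!scalerDl => /eqP; rewrite scaler_eq0 => /orP[|/eqP].
  by rewrite gt_eqF // !addr_gt0.
exact: unit_neq0.
Qed.

Lemma pos_unit_eq (R : realType) (p q : R) (x y : vec R) :
  0 < p -> 0 < q -> ldot x x = 1 -> ldot y y = 1 -> p *: x = q *: y -> x = y.
Proof.
move=> p0 q0 xx yy e.
have : ldot (p *: x) (p *: x) = ldot (q *: y) (q *: y) by rewrite e.
rewrite !ldotE xx yy !mulr1 -!expr2 => /eqP.
rewrite eqrXn2 ?ltW // => /eqP pq; subst q.
by apply: (scalerI _ e); rewrite gt_eqF.
Qed.

(** By [frame_flip] the two reversals force N3 = N2 and N4 = N1. The closing sum then equates two
    unit vectors, whence N1 = N2 and T1 = T2, against N2 - N1 = r1 (T1 + T2) with r1 > 0. *)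
Lemma chain_no_turn (R : realType) (c : vec R) (d phi : R)
    (N1 N2 N3 N4 T1 T2 T3 T4 : vec R) (b1 b2 b3 b4 : R) :
  tangent_chain c d phi N1 N2 N3 N4 T1 T2 T3 T4 b1 b2 b3 b4 ->
  ~ [/\ b2 = b1, b3 = - b1 & b4 = - b1].
Proof.
case=> cc [b0 e2 e3 e4] [f1 f2 f3 f4] [[[[r1 r2] r3] r4] /=
  [[? ? ? ?] d1 d2 d3 d4]].
move=> [[[[a1 a2] a3] a4] /= [[? ? ? ?] [u1 u2 _ _] cl]] [? ? ?]; subst b2 b3 b4.
have [N32 T32] := frame_flip cc b0 f2 f3 d2.
rewrite -[b1]opprK in f1; have b0' : - b1 != 0 by rewrite oppr_eq0.
have [N14 T14] := frame_flip cc b0' f4 f1 d4.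
have {}T14 : T4 = - T1 by rewrite T14 opprK.
rewrite opprK in f1.
have eqR : rot_tangent phi N1 T1 = rot_tangent phi N2 T2.
  apply: (@pos_unit_eq _ (a1 + a4) (a2 + a3)); rewrite ?addr_gt0 //.
  apply/eqP; rewrite -subr_eq0 -cl N32 T32 -N14 T14 !rot_tangentN.
  by apply/eqP; apply: vec_ext; coords; ring.
have N12 : N1 = N2.
  apply: (rot_tangent_null_inj (phi := phi) cc b0 f1 f2).
  by rewrite eqR subrr; coords; ring.
rewrite -N12 in f2 d1; have T12 := frame_same b0 f1 f2.
move: d1; rewrite subrr -T12 => /esym/eqP.
rewrite scaler_eq0 gt_eqF //= -mulr2n -scaler_nat scaler_eq0 pnatr_eq0 /=.
by move/eqP; apply: unit_neq0; case: f1.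
Qed.

(** All b_i agree up to sign. The two patterns with b3 = - b1 and b4 = - b2 are cyclic shifts of
    each other, and [chain_no_turn] excludes both. *)
Lemma chain_opposite (R : realType) (c : vec R) (d phi : R)
    (N1 N2 N3 N4 T1 T2 T3 T4 : vec R) (b1 b2 b3 b4 : R) :
  tangent_chain c d phi N1 N2 N3 N4 T1 T2 T3 T4 b1 b2 b3 b4 ->
  (b1 = b3 /\ N1 <> N3) \/ (b2 = b4 /\ N2 <> N4).
Proof.
move=> h; have h' := tangent_chain_rot h.
case: (h) => _ [b0 /eqP e2 /eqP e3 /eqP e4] _ _ _.
move: e2 e3 e4; rewrite !eqf_sqr => /orP[]/eqP ? /orP[]/eqP ? /orP[]/eqP ?; subst;
  try (by left; split => //; apply: (chain_opposite_neq h));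
  try (by right; split => //; apply: (chain_opposite_neq h')).
  by case: (chain_no_turn h).
by case: (chain_no_turn h'); rewrite opprK.
Qed.

(** * Isotropic lines as isotropic planes of R^{2,2} *)

(* For A = ((w_1 + w_3, r - w_2), (r + w_2, w_1 - w_3)), both scalars vanish iff
   A (q_1, q_2)^T = 0 when sg = 1, and iff (q_2, q_1) A = 0 when sg = -1. *)
Definition spin1 (R : realType) (sg : R) (q : R * R) (w : vec R) (r : R) : R :=
  q.1 * (w 0 0 + sg * w 0 2) + q.2 * (r - w 0 1).

Definition spin2 (R : realType) (sg : R) (q : R * R) (w : vec R) (r : R) : R :=
  q.2 * (sg * w 0 2 - w 0 0) - q.1 * (r + w 0 1).

Definition spin_contact (R : realType) (sg : R) (q : R * R) (p : vec R)
    (S : osphere R) : Prop :=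
  spin1 sg q (p - center S) (radius S) = 0 /\
  spin2 sg q (p - center S) (radius S) = 0.

(** The quadratic parametrization of the light cone by spinors; [sg] is the time orientation. *)
Definition spin_dir (R : realType) (sg : R) (q : R * R) : vec R :=
  vec3 (q.2 ^+ 2 - q.1 ^+ 2) (2 * q.1 * q.2) (sg * (q.2 ^+ 2 + q.1 ^+ 2)).

(* The two spinor equations at (n, 1) are proportional when <n, n> = 1; the
   second branch solves them where the first would give q = 0. *)
Definition spinor (R : realType) (sg : R) (n : vec R) : R * R :=
  if n 0 1 == 1 then (sg * n 0 2 - n 0 0, n 0 1 + 1)
  else (n 0 1 - 1, n 0 0 + sg * n 0 2).

Lemma spinor_neq0 (R : realType) (sg : R) (n : vec R) :
  (spinor sg n).2 ^+ 2 + (spinor sg n).1 ^+ 2 != 0.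
Proof.
rewrite paddr_eq0 ?sqr_ge0 // !sqrf_eq0 /spinor.
case: (n 0 1 =P 1) => [->|/eqP n1] /=; rewrite negb_and; apply/orP.
  by left; rewrite -mulr2n pnatr_eq0.
by right; rewrite subr_eq0.
Qed.

Lemma spinorP (R : realType) (sg : R) (n : vec R) :
  sg ^+ 2 = 1 -> ldot n n = 1 ->
  spin1 sg (spinor sg n) n 1 = 0 /\ spin2 sg (spinor sg n) n 1 = 0.
Proof.
rewrite /ldot /spin1 /spin2 /spinor.
move: (n 0 0) (n 0 1) (n 0 2) => x y z s2 nn.
have s2z : (sg * z) ^+ 2 = z ^+ 2 by rewrite exprMn s2 mul1r.
by case: eqP => [y1|_] /=; split; nra.
Qed.

Lemma spin_dir_isotropic (R : realType) (sg : R) (q : R * R) :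
  sg ^+ 2 = 1 -> ldot (spin_dir sg q) (spin_dir sg q) = 0.
Proof.
move=> s2; rewrite /ldot /spin_dir !vec3E.
transitivity ((1 - sg ^+ 2) * (q.2 ^+ 2 + q.1 ^+ 2) ^+ 2); first by ring.
by rewrite s2 subrr mul0r.
Qed.

Lemma spin_dir_neq0 (R : realType) (sg : R) (q : R * R) :
  sg ^+ 2 = 1 -> q.2 ^+ 2 + q.1 ^+ 2 != 0 -> spin_dir sg q != 0.
Proof.
move=> s2 q0; apply/eqP => /rowP /(_ 2); rewrite /spin_dir vec3E mxE.
move/eqP; rewrite mulf_eq0 (negbTE q0) orbF -sqrf_eq0 s2.
by rewrite oner_eq0.
Qed.

Lemma spin_contact_line (R : realType) (sg : R) (q : R * R) (S : osphere R)
    (l : oline R) :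
  sg ^+ 2 = 1 -> q.2 ^+ 2 + q.1 ^+ 2 != 0 -> line_dir l = spin_dir sg q ->
  spin_contact sg q (line_pt l) S -> line_contact S l.
Proof.
case: S => m r; rewrite /spin_contact /line_contact /=.
move=> s2 q0 ->; move: (line_pt l - m) => w [].
rewrite /spin1 /spin2; case: q q0 => s c /= q0.
have qp : 0 < c ^+ 2 + s ^+ 2 by rewrite lt_def q0 addr_ge0 ?sqr_ge0.
have nuE : line_nu (spin_dir sg (s, c)) =
    vec3 (- (2 * s * c) / (c ^+ 2 + s ^+ 2))
         ((c ^+ 2 - s ^+ 2) / (c ^+ 2 + s ^+ 2)) 0.
  rewrite /line_nu /spin_dir !vec3E /=.
  have -> : (c ^+ 2 - s ^+ 2) ^+ 2 + (2 * s * c) ^+ 2 = (c ^+ 2 + s ^+ 2) ^+ 2.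
    by ring.
  by rewrite sqrtr_sqr gtr0_norm.
(* The third coordinate of [line_nu] is 0, so that of w fixes the parameter. *)
move=> e1 e2; exists (sg * w 0 2 / (c ^+ 2 + s ^+ 2)).
rewrite nuE /spin_dir.
have w0E : (c ^+ 2 + s ^+ 2) * w 0 0 =
    (c ^+ 2 - s ^+ 2) * (sg * w 0 2) - 2 * s * c * r.
  move: e1 e2; move: (w 0 0) (w 0 1) (w 0 2) => x y z e1 e2.
  apply/eqP; rewrite -subr_eq0; apply/eqP.
  transitivity (s * (s * (x + sg * z) + c * (r - y))
                - c * (c * (sg * z - x) - s * (r + y))); first by ring.
  by rewrite e1 e2 !mulr0 subr0.
have w1E : (c ^+ 2 + s ^+ 2) * w 0 1 =
    2 * s * c * (sg * w 0 2) + (c ^+ 2 - s ^+ 2) * r.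
  move: e1 e2; move: (w 0 0) (w 0 1) (w 0 2) => x y z e1 e2.
  apply/eqP; rewrite -subr_eq0; apply/eqP.
  transitivity ((- c) * (s * (x + sg * z) + c * (r - y))
                - s * (c * (sg * z - x) - s * (r + y))); first by ring.
  by rewrite e1 e2 !mulr0 subr0.
apply: vec_ext; rewrite !(vec3E, mxE); apply: (mulfI q0).
- by rewrite w0E; move: (w 0 2) => z /=; field.
- by rewrite w1E; move: (w 0 2) => z /=; field.
rewrite -[LHS]mul1r -s2.
by move: (w 0 2) => z /=; field.
Qed.

(** For r = 0 the matrix has determinant <w, w>, which vanishes because the kernel is nonzero. *)
Lemma spin_null (R : realType) (sg : R) (q : R * R) (w : vec R) :
  sg ^+ 2 = 1 -> q.2 ^+ 2 + q.1 ^+ 2 != 0 ->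
  spin1 sg q w 0 = 0 -> spin2 sg q w 0 = 0 -> ldot w w = 0.
Proof.
rewrite /spin1 /spin2 /ldot; case: q => s c /=.
move: (w 0 0) (w 0 1) (w 0 2) => x y z s2 q0 e1 e2.
apply: (mulfI q0); rewrite mulr0.
rewrite -[z * z]mul1r -s2.
have -> : (c ^+ 2 + s ^+ 2) * (x * x + y * y - sg ^+ 2 * (z * z)) =
  (s * (x - sg * z) - c * y) * (s * (x + sg * z) + c * (0 - y))
  - (s * y + c * (x + sg * z)) * (c * (sg * z - x) - s * (0 + y)) by ring.
by rewrite e1 e2 !mulr0 subr0.
Qed.

(** Proportional spinors annihilate both (n, 1) and (n', 1), hence (n - n', 0), and [spin_null]
    applies. *)
Lemma spinor_indep (R : realType) (sg : R) (n n' : vec R) :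
  sg ^+ 2 = 1 -> ldot n n = 1 -> ldot n' n' = 1 ->
  (spinor sg n).1 * (spinor sg n').2 = (spinor sg n).2 * (spinor sg n').1 ->
  ldot (n - n') (n - n') = 0.
Proof.
move=> s2 nn nn' qq.
have [e1 e2] := spinorP s2 nn; have [e1' e2'] := spinorP s2 nn'.
have := spinor_neq0 sg n; have := spinor_neq0 sg n'.
move: qq e1 e2 e1' e2'; case: (spinor sg n) => s c.
case: (spinor sg n') => s' c' /= qq e1 e2 e1' e2' q'0 q0.
have coll : s' * (c ^+ 2 + s ^+ 2) = s * (s * s' + c * c') /\
            c' * (c ^+ 2 + s ^+ 2) = c * (s * s' + c * c').
  split.
    have -> : s' * (c ^+ 2 + s ^+ 2) = c * (c * s') + s ^+ 2 * s' by ring.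
    by rewrite -qq; ring.
  have -> : c' * (c ^+ 2 + s ^+ 2) = c ^+ 2 * c' + s * (s * c') by ring.
  by rewrite qq; ring.
have lam0 : s * s' + c * c' != 0.
  apply: contra_neq q'0 => l0; move: coll; rewrite l0 !mulr0 =>
    -[/eqP h1 /eqP h2].
  move: h1 h2; rewrite !mulf_eq0 (negbTE q0) !orbF => /eqP -> /eqP ->.
  by rewrite expr0n addr0.
have tr (f : R * R -> R) : (forall a x y, f (a * x, a * y) = a * f (x, y)) ->
    f (s', c') = 0 -> f (s, c) = 0.
  move=> fl f0; apply: (mulfI lam0); rewrite mulr0 -fl.
  by rewrite ![(s * s' + c * c') * _]mulrC -coll.1 -coll.2
    ![_ * (c ^+ 2 + _)]mulrC
    fl f0 mulr0.
have h1 : spin1 sg (s, c) n' 1 = 0.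
  by apply: (tr (fun q => spin1 sg q n' 1)) => // a x y; rewrite /spin1 /=;
    move: (n' 0 0) (n' 0 1) (n' 0 2) => *; ring.
have h2 : spin2 sg (s, c) n' 1 = 0.
  by apply: (tr (fun q => spin2 sg q n' 1)) => // a x y; rewrite /spin2 /=;
    move: (n' 0 0) (n' 0 1) (n' 0 2) => *; ring.
apply: (@spin_null _ sg (s, c)) => //.
  transitivity (spin1 sg (s, c) n 1 - spin1 sg (s, c) n' 1).
    by rewrite /spin1; coords => /=; ring.
  by rewrite e1 h1 subrr.
transitivity (spin2 sg (s, c) n 1 - spin2 sg (s, c) n' 1).
  by rewrite /spin2; coords => /=; ring.
by rewrite e2 h2 subrr.
Qed.

(* A plane of one kind and a plane of the other kind through a common point of
   R^{2,2} meet in a line. *)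
Lemma spin_share (R : realType) (sg : R) (q q' : R * R) (p p' : vec R)
    (S S' : osphere R) :
  sg ^+ 2 = 1 -> spin_contact sg q p S -> spin_contact sg q p S' ->
  spin_contact (- sg) q' p' S' ->
  q.2 * spin1 (- sg) q' (p' - center S) (radius S)
  = q.1 * spin2 (- sg) q' (p' - center S) (radius S).
Proof.
case: S => m r; case: S' => m' r'.
rewrite /spin_contact /= => s2 [a1 a2] [b1 b2] [c1 c2].
apply/eqP; rewrite -subr_eq0; apply/eqP.
(* On linear parts, q.2 spin1 - q.1 spin2 for - sg and q' equals q'.2 spin1 - q'.1 spin2 for sg and
   q; in differences of S and S' the base points cancel. *)
transitivity (q'.2 * (spin1 sg q (p - m) r - spin1 sg q (p - m') r')
  - q'.1 * (spin2 sg q (p - m) r - spin2 sg q (p - m') r')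
  + (q.2 * spin1 (- sg) q' (p' - m') r' - q.1 * spin2 (- sg) q' (p' - m') r')).
  by rewrite /spin1 /spin2; coords; ring.
by rewrite a1 a2 b1 b2 c1 c2; ring.
Qed.

Lemma indep_eq0 (R : realType) (s c s' c' x y : R) :
  s * c' != c * s' -> c * x = s * y -> c' * x = s' * y -> x = 0 /\ y = 0.
Proof.
rewrite -subr_eq0 => d0 e e'; split; apply: (mulfI d0); rewrite mulr0.
  have -> : (s * c' - c * s') * x = s * (c' * x) - s' * (c * x) by ring.
  by rewrite e e'; ring.
have -> : (s * c' - c * s') * y = c' * (s * y) - c * (s' * y) by ring.
by rewrite -e -e'; ring.
Qed.

Lemma spin_meet (R : realType) (sg : R) (q q' : R * R) (p p' : vec R) :
  sg ^+ 2 = 1 -> q.1 * q'.2 != q.2 * q'.1 ->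
  exists S : osphere R, spin_contact sg q p S /\ spin_contact sg q' p' S.
Proof.
case: q q' => s c [s' c'] /= s2; rewrite -subr_eq0 => d0.
(* For the sought centre m and radius r put A = m_1 + sg m_3, B = r + m_2, C = m_1 - sg m_3, E = r -
   m_2. The equations split into two 2x2 systems, solved by Cramer's rule. *)
pose e := s * (p 0 0 + sg * p 0 2) - c * p 0 1.
pose e' := s' * (p' 0 0 + sg * p' 0 2) - c' * p' 0 1.
pose f := c * (p 0 0 - sg * p 0 2) + s * p 0 1.
pose f' := c' * (p' 0 0 - sg * p' 0 2) + s' * p' 0 1.
pose D := s * c' - c * s'.
pose A := (c' * e - c * e') / D; pose B := (s' * e - s * e') / D.
pose C := (s * f' - s' * f) / D; pose E := (c * f' - c' * f) / D.
exists (OSphere (vec3 ((A + C) / 2) ((B - E) / 2) (sg * (A - C) / 2))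
                ((B + E) / 2)).
have sgE (x y : R) : sg * (x - sg * y / 2) = sg * x - y / 2.
  by rewrite mulrBr !mulrA -expr2 s2 mul1r.
by split; split; rewrite /spin1 /spin2 /= !(vec3E, mxE) sgE
  /A /B /C /E /e /e' /f /f' /D;
  move: (p 0 0) (p 0 1) (p 0 2) (p' 0 0) (p' 0 1) (p' 0 2) => *; field.
Qed.

(** S is the meeting point of the planes of q1 and q3. Each other plane shares a sphere with both,
    so [spin_share] gives two independent equations for its two scalars at S. *)
Lemma spin_quad (R : realType) (sg : R) (q1 q2 q3 q4 : R * R)
    (p1 p2 p3 p4 : vec R) (S1 S2 S3 S4 : osphere R) :
  sg ^+ 2 = 1 -> q1.1 * q3.2 != q1.2 * q3.1 ->
  spin_contact sg q1 p1 S1 -> spin_contact sg q1 p1 S2 ->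
  spin_contact (- sg) q2 p2 S2 -> spin_contact (- sg) q2 p2 S3 ->
  spin_contact sg q3 p3 S3 -> spin_contact sg q3 p3 S4 ->
  spin_contact (- sg) q4 p4 S4 -> spin_contact (- sg) q4 p4 S1 ->
  exists S : osphere R,
    [/\ spin_contact sg q1 p1 S, spin_contact (- sg) q2 p2 S,
        spin_contact sg q3 p3 S & spin_contact (- sg) q4 p4 S].
Proof.
move=> s2 d0 c11 c12 c22 c23 c33 c34 c44 c41.
have [S [h1 h3]] := spin_meet p1 p3 s2 d0.
exists S; split=> //.
- have := spin_share s2 h3 c33 c23; have := spin_share s2 h1 c12 c22.
  exact: indep_eq0.
have := spin_share s2 h3 c34 c44; have := spin_share s2 h1 c11 c41.
exact: indep_eq0.
Qed.

(** * Koebe nets and their associated spheres *)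

(** Being orthogonal to the complement of g, t is parallel to g. *)
Lemma orthogonal_proj_eq0 (R : realType) (g t y : vec R) :
  ldot g g != 0 -> ldot g t != 0 ->
  (forall u, ldot u g = 0 -> ldot t u = 0) ->
  ldot t y = 0 -> ldot g y = 0.
Proof.
move=> g0 gt0 orth ty.
have ug : ldot (ldot g g *: y - ldot g y *: g) g = 0.
  by rewrite !ldotE (ldotC y); ring.
have := orth _ ug; rewrite !ldotE ty mulr0 sub0r => /eqP.
by rewrite oppr_eq0 mulf_eq0 (ldotC t) (negbTE gt0) orbF => /eqP.
Qed.

Lemma sq_ldot_tangent (R : realType) (g t : vec R) :
  (forall u, ldot u g = 0 -> ldot t u = 0) ->
  ldot g t ^+ 2 = ldot g g * ldot t t.
Proof.
move=> orth.
have ug : ldot (ldot g g *: t - ldot g t *: g) g = 0.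
  by rewrite !ldotE (ldotC t); ring.
have := orth _ ug; rewrite !ldotE (ldotC t g) => /eqP.
by rewrite subr_eq0 expr2 => /eqP.
Qed.

Lemma circle_neq_pt (R : realType) (C : spacelike_circle R) (p : vec R) :
  exists2 x, x <> p & on_circle C x.
Proof.
have [x [y [xy Sx Sy cx cy]]] := circle_proper C.
case: (x =P p) => [xp|xp]; last by exists x.
by exists y => //; move=> yp; rewrite xp yp eqxx in xy.
Qed.

(** Orthogonality makes the radius N - m of the sphere parallel to the tangent of the circle at N.
    This tangent is orthogonal to the axis and, as the circle lies on <x, x> = -1, to N. *)
Lemma orthogonal_circle_radius (R : realType) (C : spacelike_circle R)
    (S : osphere R) (N : vec R) :
  (forall x, on_circle C x -> ldot x x = -1) ->
  radius S != 0 -> meets_orthogonally C S N ->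
  ldot (N - center S) (circle_normal C) = 0 /\ ldot (N - center S) N = 0.
Proof.
move=> CU r0 [[CN cN] SN orth].
have cc := circle_spacelike C; set c := circle_normal C in cc cN orth *.
set g := N - center S in SN *.
have gg : ldot g g != 0 by rewrite SN sqrf_eq0.
pose mu := (circle_offset C - ldot (center (circle_sphere C)) c) / ldot c c.
have cc0 : ldot c c != 0 by rewrite lt_eqF.
(* [q] is the centre of the circle in its plane. *)
pose q := center (circle_sphere C) + mu *: c.
have qc : ldot q c = circle_offset C.
  by rewrite /q ldotDl ldotZl /mu divfK // addrC subrK.
have on_circleE y : ldot y c = 0 ->
    on_circle C (q + y) <-> ldot y y = ldot (N - q) (N - q).
  move=> yc; have ac : ldot (N - q) c = 0 by rewrite ldotBl cN qc subrr.
  rewrite /on_circle /on_sphere -/c (ldotDl q y c) qc yc addr0 -CN.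
  have -> : q + y - center (circle_sphere C) = y + mu *: c.
    by rewrite /q; apply: vec_ext; coords; ring.
  have -> : N - center (circle_sphere C) = (N - q) + mu *: c.
    by rewrite /q; apply: vec_ext; coords; ring.
  move: ac; move: (N - q) => a ac.
  rewrite !ldotE !(ldotC c) yc ac; split=> [[]|->]; last by [].
  by rewrite !mulr0 !addr0 => /addIr.
set a := N - q in on_circleE.
have ac : ldot a c = 0 by rewrite ldotBl cN qc subrr.
(* A circle of radius 0 in a definite plane would have no second point. *)
have a0 : a != 0.
  apply/eqP => a0; have [x xN Cx] := circle_neq_pt C N; apply: xN.
  have Nq : N = q by apply/eqP; rewrite -subr_eq0; apply/eqP.
  have xc : ldot (x - q) c = 0 by case: Cx => _ e; rewrite ldotBl e qc subrr.
  have := (on_circleE _ xc).1; rewrite addrC subrK => /(_ Cx).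
  rewrite a0 => xx; rewrite Nq; apply/eqP; rewrite -subr_eq0; apply/eqP.
  apply: (timelike_orth_eq0 cc xc); rewrite xx.
  by coords; ring.
have aa := timelike_orth_gt0 cc ac a0.
pose k := Num.sqrt (- ldot c c).
have k2 : k ^+ 2 = - ldot c c by rewrite sqr_sqrtr // oppr_ge0 ltW.
have k0 : k != 0 by rewrite -sqrf_eq0 k2 oppr_eq0.
pose t := lcross a c.
have tc : ldot t c = 0 := ldot_crossr a c.
have tt : ldot t t = ldot a a * k ^+ 2.
  by rewrite /t ldot_cross_cross ac k2; ring.
(* The quarter turns q + k^-1 t and q - k^-1 t of N lie on the circle, hence on
   the hyperboloid, so that t is orthogonal to q. *)
have qt : ldot q t = 0.
  pose z := k^-1 *: t.
  have zc : ldot z c = 0 by rewrite ldotZl tc mulr0.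
  have zz : ldot z z = ldot a a.
    by rewrite ldotZl ldotZr tt; field.
  have h1 := CU _ ((on_circleE _ zc).2 zz).
  have h2 : ldot (q - z) (q - z) = -1.
    have nzc : ldot (- z) c = 0.
      by rewrite -scaleN1r (ldotZl (-1) z c) zc mulr0.
    apply: CU; apply: (on_circleE _ nzc).2.
    by rewrite -scaleN1r (ldotZl (-1) z) (ldotZr (-1) z) zz -/a; ring.
  have polar (x y : vec R) :
      ldot (x + y) (x + y) - ldot (x - y) (x - y) = 4 * ldot x y.
    by coords; ring.
  have := polar q z; rewrite h1 h2 subrr ldotZr => /esym/eqP.
  by rewrite !mulf_eq0 invr_eq0 (negbTE k0) pnatr_eq0 /= => /eqP.
have tN : ldot t N = 0.
  have -> : N = q + a by rewrite addrC subrK.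
  by rewrite ldotDr (ldotC t q) qt ldot_crossl add0r.
have ttan : circle_tangent C N t.
  split=> //; rewrite /sphere_tangent.
  have -> : N - center (circle_sphere C) = a + mu *: c.
    by rewrite /a /q; apply: vec_ext; coords; ring.
  by rewrite ldotDr ldotZr ldot_crossl tc mulr0 addr0.
have gorth u : ldot u g = 0 -> ldot t u = 0 by move=> ug; apply: orth.
have gt0 : ldot g t != 0.
  rewrite -sqrf_eq0 (sq_ldot_tangent gorth) mulf_neq0 // tt.
  by rewrite mulf_neq0 ?sqrf_eq0 // gt_eqF.
by split; apply: (orthogonal_proj_eq0 gg gt0 gorth).
Qed.

(** N lies on the segment between the centres, so both radius vectors are positive multiples of T;
    [orthogonal_circle_radius] gives the orthogonalities. *)
Lemma koebe_edge (R : realType) (h : net R) (f : face) (w w' b : vertex) :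
  koebe_isothermic h -> white_edge f w w' -> black b -> incident b f ->
  let N := net_pt h f in let T := edge_tangent h w w' in
  let c := circle_normal (net_circle h b) in
  [/\ [/\ 0 < net_radius h w, 0 < net_radius h w',
          N - center (net_sphere h w) = net_radius h w *: T &
          center (net_sphere h w') - N = net_radius h w' *: T],
      [/\ ldot N N = -1, ldot T T = 1 & ldot T N = 0],
      ldot T c = 0 & ldot N c = circle_offset (net_circle h b)].
Proof.
move=> [[hr _ ho] hU hb] ww' bb bf N T c.
have [ww w'w wf w'f _] := and5P ww'.
have CU x : on_circle (net_circle h b) x -> ldot x x = -1.
  by move=> /(hU _ bb) [].
have mo := ho _ _ _ ww bb wf bf; have mo' := ho _ _ _ w'w bb w'f bf.
have [gc gN] := orthogonal_circle_radius CU (hr _ ww) mo.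
have [t [t0 t1 Nt]] := hb _ _ _ ww'.
have [[CN cN] SN _] := mo; have [_ SN' _] := mo'.
have r0 : 0 < net_radius h w by rewrite normr_gt0 hr.
have r0' : 0 < net_radius h w' by rewrite normr_gt0 hr.
rewrite /T /edge_tangent; 
set e := center (net_sphere h w') - center (net_sphere h w).
have Ne : N - center (net_sphere h w) = t *: e.
  rewrite /N Nt /e; apply: vec_ext; coords; ring.
have Ne' : center (net_sphere h w') - N = (1 - t) *: e.
  by rewrite /N Nt /e; apply: vec_ext; coords; ring.
clearbody e.
have r2 : radius (net_sphere h w) ^+ 2 = t ^+ 2 * ldot e e.
  by rewrite -SN -/N Ne ldotZl ldotZr; ring.
have r2' : radius (net_sphere h w') ^+ 2 = (1 - t) ^+ 2 * ldot e e.
  rewrite -SN' -/N -[N - _]opprB Ne' -scaleN1r scalerA ldotZl ldotZr; ring.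
have ee : 0 < ldot e e.
  rewrite -(pmulr_rgt0 _ (exprn_gt0 2 t0)) -r2 lt_def sqr_ge0 sqrf_eq0.
  by rewrite andbT hr.
have L0 : 0 < lnorm e by rewrite sqrtr_gt0.
have L2 : lnorm e ^+ 2 = ldot e e by rewrite sqr_sqrtr // ltW.
have radE (u v : R) : 0 < u -> v ^+ 2 = u ^+ 2 * ldot e e -> `|v| = u * lnorm e.
  move=> u0 vE; apply/eqP; rewrite -(@eqrXn2 _ 2) ?normr_ge0 ?mulr_ge0 ?ltW //.
  by rewrite real_normK ?num_real // vE exprMn L2.
have RE := radE _ _ t0 r2.
have t1' : 0 < 1 - t by rewrite subr_gt0.
have RE' := radE _ _ t1' r2'.
have zero (u : vec R) : ldot (N - center (net_sphere h w)) u = 0 ->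
    ldot ((lnorm e)^-1 *: e) u = 0.
  rewrite Ne ldotZl => /eqP; rewrite mulf_eq0 gt_eqF //= => /eqP eu.
  by rewrite ldotZl eu mulr0.
split=> //.
- split=> //; rewrite ?Ne ?Ne' /net_radius ?RE ?RE' scalerA mulfK ?gt_eqF //.
- split; [exact: CU | | exact: zero].
  by rewrite ldotZl ldotZr -L2 expr2 mulKf ?mulVf ?gt_eqF.
exact: zero.
Qed.

(** For b = 0 the plane of the circle would be tangent to the hyperboloid at N and contain no second
    point of it. *)
Lemma circle_frame_neq0 (R : realType) (C : spacelike_circle R)
    (N T : vec R) (b : R) :
  (forall x, on_circle C x -> ldot x x = -1) -> ldot N N = -1 ->
  circle_frame (circle_normal C) (circle_offset C) N T b -> b != 0.
Proof.
move=> CU NN [Nc _ _ bTN b2]; apply/eqP => b0.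
have cc := circle_spacelike C.
have [x xN Cx] := circle_neq_pt C N.
have xx := CU _ Cx; have [_ xc] := Cx.
have Dc : ldot (x - N) (circle_normal C) = 0 by rewrite ldotBl xc Nc subrr.
apply: xN; apply/eqP; rewrite -subr_eq0; apply/eqP.
apply: (timelike_orth_eq0 cc Dc).
move: b2 bTN; rewrite b0 scale0r expr0n /= => b2 /esym/eqP.
rewrite addr_eq0 => /eqP cN.
have d0 : circle_offset C != 0.
  by rewrite -sqrf_eq0 gt_eqF //; lra.
move: Dc; rewrite cN -scaleNr ldotZr => /eqP.
rewrite mulf_eq0 oppr_eq0 (negbTE d0) /= => /eqP DN.
have xE : x = N + (x - N) by rewrite addrC subrK.
clear cN; move: xx; rewrite {1 2}xE; move: DN; move: (x - N) => D DN.
by rewrite !ldotE (ldotC N D) DN NN !addr0 add0r => /eqP; rewrite -subr_eq0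
  addrAC subrr add0r => /eqP.
Qed.

(* At a white vertex the sign [radius (s w) * net_radius h w] is +-1, and it
   alternates along the white edges. *)
Lemma assoc_edge (R : realType) (h : net R) (phi : R) (s : vertex -> osphere R)
    (f : face) (w w' : vertex) :
  associated_spheres h phi s -> white_edge f w w' ->
  0 < net_radius h w -> 0 < net_radius h w' ->
  let u := rotated_tangent h phi f w w' in
  ldot u u = 1 ->
  let sg := if horizontal w w' then 1 else -1 in
  let e := radius (s w) * net_radius h w in
  [/\ e ^+ 2 = 1, radius (s w') * net_radius h w' = - e,
      radius (s w) != radius (s w') &
      center (s w') - center (s w)
      = (radius (s w) - radius (s w')) *: ((sg * e) *: u)].
Proof.
move=> [hc hr ho] ww'; have [ww w'w _ _ _] := and5P ww'.
have := hc _ _ _ ww'; have [_ _ _] := ho _ _ _ ww'.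
have := hr _ ww; have := hr _ w'w.
set u := rotated_tangent h phi f w w'.
set r := radius (s w); set r' := radius (s w').
set a := net_radius h w; set a' := net_radius h w'.
move=> rE' rE; rewrite -opprB; set D := _ - center (s w).
move=> DD DE a0 a0' u' uu sg e; rewrite /u' -/u in uu *; clear u'; clearbody u D.
have a1 : a != 0 by rewrite gt_eqF.
have a1' : a' != 0 by rewrite gt_eqF.
have e2 : e ^+ 2 = 1.
  by rewrite exprMn -(real_normK (num_real r)) rE -exprMn mulVf // expr1n.
have e2' : (r' * a') ^+ 2 = 1.
  by rewrite exprMn -(real_normK (num_real r')) rE' -exprMn mulVf // expr1n.
have rr : (r - r') ^+ 2 = (a^-1 + a'^-1) ^+ 2.
  rewrite -DD -scaleN1r !ldotE DE !ldotE uu.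
  by case: ifP => _; ring.
(* Oriented contact expands to r r' = - (a a')^-1, so the radii have opposite signs. *)
have ee' : e * (r' * a') = -1.
  have : r * r' = - (a^-1 * a'^-1).
    have : r ^+ 2 = a^-1 ^+ 2 by rewrite -rE real_normK ?num_real.
    have : r' ^+ 2 = a'^-1 ^+ 2 by rewrite -rE' real_normK ?num_real.
    move: rr; move: a^-1 a'^-1 => b b' h1 h2 h3; lra.
  move=> rr'; transitivity (r * r' * (a * a')); first by rewrite /e; ring.
  by rewrite rr'; field; rewrite a1 a1'.
have eN : r' * a' = - e.
  by rewrite -[LHS]mul1r -e2 expr2 -mulrA ee' mulrN1.
have rE2 : r = e / a by rewrite mulfK.
have rE2' : r' = - e / a' by rewrite -eN mulfK.
have rd : r - r' = e * (a^-1 + a'^-1) by rewrite rE2 rE2'; ring.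
split=> //.
  rewrite -subr_eq0 rd mulf_neq0 //; first by rewrite -sqrf_eq0 e2 oner_eq0.
  by rewrite gt_eqF // addr_gt0 ?invr_gt0.
rewrite rd DE scalerA; congr (_ *: _).
rewrite -/sg; transitivity (e ^+ 2 * (sg * (a^-1 + a'^-1))); last by ring.
by rewrite e2 mul1r.
Qed.

(** * Isotropic lines at the faces *)

Definition white_pair (f : face) : vertex * vertex :=
  if white f then (f, (f.1 + 1, f.2 + 1))
  else ((f.1 + 1, f.2), (f.1, f.2 + 1)).

Lemma white_edgeP (f : face) (w w' : vertex) :
  white_edge f w w' -> (w, w') = white_pair f \/ (w', w) = white_pair f.
Proof.
case: f w w' => i j [a b] [a' b'].
rewrite /white_edge /white /incident /white_pair /white /= xpair_eqE.
case: ifP => ij; case/and5P => h1 h2 /andP[/orP[]/eqP ? /orP[]/eqP ?];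
  move=> /andP[/orP[]/eqP ? /orP[]/eqP ?]; subst;
  rewrite ?eqxx ?andbF //= => h3; try (by left); try (by right); lia.
Qed.

(** The quotient is symmetric in the two white vertices, so the direction of the edge does not
    matter. *)
Definition face_normal (R : realType) (s : vertex -> osphere R) (f : face) :
    vec R :=
  let w := white_pair f in
  (radius (s w.1) - radius (s w.2))^-1 *: (center (s w.2) - center (s w.1)).

Definition face_point (R : realType) (s : vertex -> osphere R) (f : face) :
    vec R :=
  let w := (white_pair f).1 in
  center (s w) + radius (s w) *: face_normal s f.

Lemma face_normalE (R : realType) (s : vertex -> osphere R) (f : face)
    (w w' : vertex) (u : vec R) :
  white_edge f w w' -> radius (s w) != radius (s w') ->
  center (s w') - center (s w) = (radius (s w) - radius (s w')) *: u ->
  [/\ face_normal s f = u,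
      face_point s f - center (s w) = radius (s w) *: u &
      face_point s f - center (s w') = radius (s w') *: u].
Proof.
rewrite -subr_eq0 => ww' r0 cE; rewrite /face_point.
have nE : face_normal s f = u.
  rewrite /face_normal; case: (white_edgeP ww') => <- /=.
    by rewrite cE scalerA mulVf // scale1r.
  rewrite -[center (s w) - _]opprB cE -scaleNr opprB scalerA mulVf ?scale1r //.
  by rewrite -opprB oppr_eq0.
have cE' : center (s w') = center (s w) + (radius (s w) - radius (s w')) *: u.
  by rewrite -cE addrC subrK.
rewrite nE; split=> //; case: (white_edgeP ww') => <- /=; rewrite ?cE';
  by apply: vec_ext; coords; ring.
Qed.

Lemma spin_contact_normal (R : realType) (sg : R) (n p : vec R)
    (S : osphere R) :
  sg ^+ 2 = 1 -> ldot n n = 1 -> p - center S = radius S *: n ->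
  spin_contact sg (spinor sg n) p S.
Proof.
move=> s2 nn pS; have [e1 e2] := spinorP s2 nn.
rewrite /spin_contact pS; split.
  transitivity (radius S * spin1 sg (spinor sg n) n 1).
    by rewrite /spin1; coords; ring.
  by rewrite e1 mulr0.
transitivity (radius S * spin2 sg (spinor sg n) n 1).
  by rewrite /spin2; coords; ring.
by rewrite e2 mulr0.
Qed.

(* Faces with a horizontal white edge are the white ones in the indexing of
   faces by their lower left corner. *)
Definition face_sign (R : realType) (k : bool) (f : face) : R :=
  (-1) ^+ (k (+) white f).

Lemma face_sign_sqr (R : realType) (k : bool) (f : face) :
  face_sign R k f ^+ 2 = 1.
Proof. by rewrite /face_sign sqrr_sign. Qed.

Definition face_spinor (R : realType) (s : vertex -> osphere R) (k : bool)
    (f : face) : R * R :=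
  spinor (face_sign R k f) (face_normal s f).

(* The future directed isotropic line through [face_point s f] in the common
   tangent plane for one of the two kinds of faces, the past directed one for
   the other kind. *)
Definition face_line (R : realType) (s : vertex -> osphere R) (k : bool)
    (f : face) : oline R :=
  @OLine R (face_point s f) (spin_dir (face_sign R k f) (face_spinor s k f))
    (spin_dir_isotropic _ (face_sign_sqr R k f))
    (spin_dir_neq0 (face_sign_sqr R k f) (spinor_neq0 _ _)).

Definition face_contact (R : realType) (s : vertex -> osphere R) (k : bool)
    (f : face) (S : osphere R) : Prop :=
  spin_contact (face_sign R k f) (face_spinor s k f) (face_point s f) S.

Lemma face_contact_line (R : realType) (s : vertex -> osphere R) (k : bool)
    (f : face) (S : osphere R) :
  face_contact s k f S -> line_contact S (face_line s k f).
Proof.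
move=> fS; apply: (@spin_contact_line _ (face_sign R k f) (face_spinor s k f)).
- exact: face_sign_sqr.
- exact: spinor_neq0.
- by [].
exact: fS.
Qed.

(* [sg] is 1 on horizontal and -1 on vertical edges, [e] is the sign of the
   radius of [s w]. *)
Definition edge_data (R : realType) (h : net R) (phi : R)
    (s : vertex -> osphere R) (C : spacelike_circle R) (sg e : R)
    (f : face) (w w' : vertex) (b : R) : Prop :=
  let N := net_pt h f in let T := edge_tangent h w w' in
  let u := rot_tangent phi N T in
  [/\ circle_frame (circle_normal C) (circle_offset C) N T b /\ b != 0,
      [/\ 0 < net_radius h w, 0 < net_radius h w',
          N - center (net_sphere h w) = net_radius h w *: T &
          center (net_sphere h w') - N = net_radius h w' *: T],
      ldot u u = 1 /\ face_normal s f = (sg * e) *: u,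
      center (s w') - center (s w)
      = (sg * ((net_radius h w)^-1 + (net_radius h w')^-1)) *: u &
      [/\ e ^+ 2 = 1, radius (s w') * net_radius h w' = - e,
          (forall k, face_contact s k f (s w)) &
          (forall k, face_contact s k f (s w'))]].

Lemma edge_dataP (R : realType) (h : net R) (phi : R)
    (s : vertex -> osphere R) (v : vertex) (f : face) (w w' : vertex) (e : R) :
  koebe_isothermic h -> associated_spheres h phi s ->
  white_edge f w w' -> black v -> incident v f ->
  radius (s w) * net_radius h w = e ->
  exists b, edge_data h phi s (net_circle h v)
    (if horizontal w w' then 1 else -1) e f w w' b.
Proof.
move=> hk ha ww' bv vf re.
have [[r0 r0' Nm Nm'] [NN TT TN] Tc Nc] := koebe_edge hk ww' bv vf.
have CU x : on_circle (net_circle h v) x -> ldot x x = -1.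
  by case: hk => _ hU _ /(hU _ bv) [].
have fr := circle_frameP NN TT TN Tc; rewrite Nc in fr.
have uu := ldot_rot_tangent phi NN TT TN.
have [e2 re' rr cE] := assoc_edge ha ww' r0 r0' uu.
rewrite re in e2 re' cE; set sg := if _ then _ else _ in cE *.
have sg2 : sg ^+ 2 = 1 by rewrite /sg; case: ifP; rewrite ?sqrrN expr1n.
have [nE pE pE'] := face_normalE ww' rr cE.
have nn : ldot (face_normal s f) (face_normal s f) = 1.
  by rewrite nE ldotZl ldotZr uu mulr1 -expr2 exprMn sg2 e2 mulr1.
eexists; split; last 1 first.
- by split=> // k; (apply: spin_contact_normal;
    [exact: face_sign_sqr | exact: nn | rewrite nE]).
- by split; [exact: fr | apply: circle_frame_neq0 CU NN fr].
- by [].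
- by [].
- by case: ha => /(_ _ _ _ ww').
Qed.

(** * Spheres at the black vertices *)

Lemma face_spinor_indep (R : realType) (s : vertex -> osphere R) (k : bool)
    (h : net R) (phi d e sg b : R) (c : vec R) (f f' : face)
    (T T' : vec R) :
  ldot c c < 0 -> b != 0 -> (sg * e) ^+ 2 = 1 ->
  circle_frame c d (net_pt h f) T b -> circle_frame c d (net_pt h f') T' b ->
  let u := rot_tangent phi (net_pt h f) T in
  let u' := rot_tangent phi (net_pt h f') T' in
  ldot u u = 1 -> ldot u' u' = 1 ->
  face_normal s f = (sg * e) *: u -> face_normal s f' = (sg * e) *: u' ->
  face_sign R k f = face_sign R k f' ->
  net_pt h f <> net_pt h f' ->
  (face_spinor s k f).1 * (face_spinor s k f').2
  != (face_spinor s k f).2 * (face_spinor s k f').1.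
Proof.
(* Proportional spinors would make the normals differ by an isotropic vector, hence N = N'. *)
move=> cc b0 e2 fr fr' u u' uu uu' nE nE' sE NN'; apply/eqP => H; apply: NN'.
apply: (rot_tangent_null_inj (phi := phi) cc b0 fr fr'); rewrite -/u -/u'.
have unit v : ldot v v = 1 -> ldot ((sg * e) *: v) ((sg * e) *: v) = 1.
  by move=> vv; rewrite ldotZl ldotZr vv mulr1 -expr2.
have := @spinor_indep _ (face_sign R k f) _ _ (face_sign_sqr R k f)
  (unit _ uu) (unit _ uu').
rewrite -nE -nE' {2 4}sE => /(_ H).
by rewrite nE nE' -scalerBr ldotZl ldotZr mulrA -expr2 e2 mul1r.
Qed.

(** [chain_opposite] finds two opposite faces with independent spinors, and [spin_quad] starts from
    them. *)
Lemma black_sphere (R : realType) (h : net R) (phi : R)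
    (s : vertex -> osphere R) (v : vertex) (f1 f2 f3 f4 : face)
    (w1 w2 w3 w4 : vertex) (k : bool) :
  koebe_isothermic h -> associated_spheres h phi s -> black v ->
  [/\ incident v f1, incident v f2, incident v f3 & incident v f4] ->
  [/\ white_edge f1 w1 w2, white_edge f2 w2 w3, white_edge f3 w3 w4 &
      white_edge f4 w4 w1] ->
  [/\ horizontal w2 w3 = ~~ horizontal w1 w2,
      horizontal w3 w4 = horizontal w1 w2 &
      horizontal w4 w1 = ~~ horizontal w1 w2] ->
  [/\ white f2 = ~~ white f1, white f3 = white f1 & white f4 = ~~ white f1] ->
  exists S : osphere R,
    [/\ face_contact s k f1 S, face_contact s k f2 S, face_contact s k f3 S &
        face_contact s k f4 S].
Proof.
move=> hk ha bv [v1 v2 v3 v4] [we1 we2 we3 we4] [h2 h3 h4] [t2 t3 t4].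
have [b1 D1] := edge_dataP hk ha we1 bv v1 erefl.
(* Each edge hands the negated sign of the radius on to the next. *)
have [b2 D2] := edge_dataP hk ha we2 bv v2
  (let: And5 _ _ _ _ (And4 _ e _ _) := D1 in e).
have [b3 D3] := edge_dataP hk ha we3 bv v3
  (let: And5 _ _ _ _ (And4 _ e _ _) := D2 in e).
have [b4 D4] := edge_dataP hk ha we4 bv v4
  (let: And5 _ _ _ _ (And4 _ e _ _) := D3 in e).
rewrite !opprK h2 h3 h4 in D1 D2 D3 D4.
have sgN : (if ~~ horizontal w1 w2 then 1 else -1)
    = - (if horizontal w1 w2 then 1 else -1) :> R.
  by case: (horizontal w1 w2); rewrite ?opprK.
have sg2 : (if horizontal w1 w2 then 1 else -1) ^+ 2 = 1 :> R.
  by case: ifP; rewrite ?sqrrN expr1n.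
rewrite sgN in D2 D4.
move: sg2 D1 D2 D3 D4; set sg : R := if _ then _ else _; clearbody sg => sg2.
set e := radius (s w1) * _; clearbody e.
have cc := circle_spacelike (net_circle h v).
move: cc; set c := circle_normal (net_circle h v) => cc.
case=> -[fr1 b10] [R1 R2 N1 N1'] [u1 n1] d1 [e2 _ c11 c12].
case=> -[fr2 b20] [_ R3 N2 N2'] [u2 n2] d2 [_ _ c22 c23].
case=> -[fr3 b30] [_ R4 N3 N3'] [u3 n3] d3 [_ _ c33 c34].
case=> -[fr4 b40] [_ _ N4 N4'] [u4 n4] d4 [_ _ c44 c41].
have chain : tangent_chain c (circle_offset (net_circle h v)) phi
    (net_pt h f1) (net_pt h f2) (net_pt h f3) (net_pt h f4)
    (edge_tangent h w1 w2) (edge_tangent h w2 w3) (edge_tangent h w3 w4)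
    (edge_tangent h w4 w1) b1 b2 b3 b4.
  split=> //.
  - by case: fr1 fr2 fr3 fr4 =>
      [_ _ _ _ ->] [_ _ _ _ ->] [_ _ _ _ ->] [_ _ _ _ ->].
  - have step (r : R) (N m N' T T' : vec R) :
        m - N = r *: T -> N' - m = r *: T' -> N' - N = r *: (T + T').
      by rewrite scalerDr => <- <-; rewrite [RHS]addrC addrA subrK.
    exists (net_radius h w2, net_radius h w3, net_radius h w4, net_radius h w1).
    by split=> //=; [exact: step N1' N2 | exact: step N2' N3
                    | exact: step N3' N4 | exact: step N4' N1].
  pose a (w w' : vertex) := (net_radius h w)^-1 + (net_radius h w')^-1.
  exists (a w1 w2, a w2 w3, a w3 w4, a w4 w1); split=> //=.
    by split; rewrite addr_gt0 ?invr_gt0.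
  (* The centre increments telescope to 0; the edge signs alternate, which yields the alternating
     closing sum. *)
  transitivity (sg *: ((center (s w2) - center (s w1))
    + (center (s w3) - center (s w2)) + (center (s w4) - center (s w3))
    + (center (s w1) - center (s w4)))).
    rewrite d1 d2 d3 d4 -/(a w1 w2) -/(a w2 w3) -/(a w3 w4) -/(a w4 w1).
    have sgK x : sg * (sg * x) = x by rewrite mulrA -expr2 sg2 mul1r.
    have sgNK x : sg * (- sg * x) = - x by rewrite mulNr mulrN sgK.
    move: (rot_tangent phi _ (edge_tangent h w1 w2))
      (rot_tangent phi _ (edge_tangent h w2 w3))
      (rot_tangent phi _ (edge_tangent h w3 w4))
      (rot_tangent phi _ (edge_tangent h w4 w1)) => x1 x2 x3 x4.
    by rewrite !scalerDr !scalerA !sgK !sgNK !scaleNr.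
  by rewrite [X in sg *: X](_ : _ = 0) ?scaler0 //; apply: vec_ext; coords; ring.
have se2 : (sg * e) ^+ 2 = 1 by rewrite exprMn sg2 e2 mulr1.
have se2' : (- sg * - e) ^+ 2 = 1 by rewrite mulrNN.
have sE : [/\ face_sign R k f1 = face_sign R k f3,
    face_sign R k f2 = face_sign R k f4 &
    face_sign R k f2 = - face_sign R k f1].
  by rewrite /face_sign t2 t3 t4 addbN signrN.
have [s13 s24 s21] := sE; have s12 : face_sign R k f1 = - face_sign R k f2.
  by rewrite s21 opprK.
have F1 S : face_contact s k f1 S <-> spin_contact (- face_sign R k f2)
    (face_spinor s k f1) (face_point s f1) S by rewrite /face_contact s12.
have F2 S : face_contact s k f2 S <-> spin_contact (- face_sign R k f1)
    (face_spinor s k f2) (face_point s f2) S by rewrite /face_contact s21.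
have F3 S : face_contact s k f3 S <-> spin_contact (face_sign R k f1)
    (face_spinor s k f3) (face_point s f3) S by rewrite /face_contact s13.
have F3' S : face_contact s k f3 S <-> spin_contact (- face_sign R k f2)
    (face_spinor s k f3) (face_point s f3) S
  by rewrite /face_contact -s13 s12.
have F4 S : face_contact s k f4 S <-> spin_contact (face_sign R k f2)
    (face_spinor s k f4) (face_point s f4) S by rewrite /face_contact s24.
have F4' S : face_contact s k f4 S <-> spin_contact (- face_sign R k f1)
    (face_spinor s k f4) (face_point s f4) S
  by rewrite /face_contact -s24 s21.
case: (chain_opposite chain) => -[bE NN].
- rewrite -bE in fr3.
  have ind := face_spinor_indep cc b10 se2 fr1 fr3 u1 u3 n1 n3 s13 NN.
  have [S [m1 m2 m3 m4]] := spin_quad (face_sign_sqr R k f1) ind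
    (c11 k) (c12 k) ((F2 _).1 (c22 k)) ((F2 _).1 (c23 k))
    ((F3 _).1 (c33 k)) ((F3 _).1 (c34 k)) ((F4' _).1 (c44 k))
    ((F4' _).1 (c41 k)).
  exists S; exact: (And4 m1 ((F2 _).2 m2) ((F3 _).2 m3) ((F4' _).2 m4)).
rewrite -bE in fr4.
have ind := face_spinor_indep cc b20 se2' fr2 fr4 u2 u4 n2 n4 s24 NN.
have [S [m2 m3 m4 m1]] := spin_quad (face_sign_sqr R k f2) ind
  (c22 k) (c23 k) ((F3' _).1 (c33 k)) ((F3' _).1 (c34 k))
  ((F4 _).1 (c44 k)) ((F4 _).1 (c41 k)) ((F1 _).1 (c11 k)) ((F1 _).1 (c12 k)).
exists S; exact: (And4 ((F1 _).2 m1) m2 ((F3' _).2 m3) ((F4 _).2 m4)).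
Qed.

Lemma white_contact (R : realType) (h : net R) (phi : R)
    (s : vertex -> osphere R) (w : vertex) (f : face) (k : bool) :
  koebe_isothermic h -> associated_spheres h phi s ->
  white w -> incident w f -> face_contact s k f (s w).
Proof.
move=> hk ha ww wf.
have [v bv vf] : exists2 v, black v & incident v f.
  case: f wf => i j _; case: (boolP (white (i, j))) => ij.
    by exists (i + 1, j); move: ij;
      rewrite /white /black /incident /= ?eqxx ?orbT //; lia.
  by exists (i, j); move: ij;
    rewrite /white /black /incident /= ?eqxx ?orbT //; lia.
have edge : exists w', white_edge f w w'.
  move: w f wf ww {vf} => [a b] [i j]; rewrite /incident /=.
  move=> /andP[/orP[]/eqP -> /orP[]/eqP ->] ww;
    [exists (i + 1, j + 1) | exists (i + 1, j) |
     exists (i, j + 1) | exists (i, j)];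
    by move: ww;
    rewrite /white_edge /white /incident /= xpair_eqE ?eqxx ?orbT /=; lia.
have [w' ww'] := edge.
have [b [_ _ _ _ [_ _ c1 _]]] := edge_dataP hk ha ww' bv vf erefl.
exact: c1.
Qed.

(** * Assembly of the two congruences *)

Lemma vertex_sphere (R : realType) (h : net R) (phi : R)
    (s : vertex -> osphere R) (k : bool) (v : vertex) :
  koebe_isothermic h -> associated_spheres h phi s ->
  exists S : osphere R, (white v -> S = s v) /\
    forall f, incident v f -> line_contact S (face_line s k f).
Proof.
move=> hk ha; case: (boolP (white v)) => [wv|bv].
  exists (s v); split=> // f vf.
  exact/face_contact_line/(white_contact k hk ha wv vf).
case: v bv => i j bv.
(* Faces and white neighbours counterclockwise, from the upper right face and the right
   neighbour. *)
have [|||||S [c1 c2 c3 c4]] := @black_sphere R h phi s (i, j)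
  (i, j) (i - 1, j) (i - 1, j - 1) (i, j - 1)
  (i + 1, j) (i, j + 1) (i - 1, j) (i, j - 1) k hk ha.
- by move: bv; rewrite /white negbK.
- by split; rewrite /incident /=; lia.
- by move: bv; split; rewrite /white_edge /white /incident /= xpair_eqE /=;
    move: bv; rewrite /white /=; lia.
- by split; rewrite /horizontal /=; lia.
- by split; move: bv; rewrite /white /=; lia.
exists S; split=> [wv|[a b]]; first by case/negP: bv.
rewrite /incident /= => vf; apply: face_contact_line.
have : (a, b) \in [:: (i, j); (i - 1, j); (i - 1, j - 1); (i, j - 1)].
  by move: vf; rewrite !inE !xpair_eqE; lia.
by rewrite !inE => /or4P[]/eqP ->.
Qed.

Theorem theorem10p4 (R : realType) (h : net R) (phi : R)
    (s : vertex -> osphere R) :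
  koebe_isothermic h ->
  associated_spheres h phi s ->
  exists c1 c2 : contact_congruence R,
    [/\ ~ same_congruence c1 c2,
        forall w : vertex, white w -> cc_sphere c1 w = s w &
        forall w : vertex, white w -> cc_sphere c2 w = s w].
Proof.
move=> hk ha.
have cong k : exists2 c : contact_congruence R, cc_line c = face_line s k &
    forall w, white w -> cc_sphere c w = s w.
  have [S HS] := choice (fun v => @vertex_sphere R h phi s k v hk ha).
  exists (ContactCongruence (fun v f => (HS v).2 f)) => // w.
  exact: (HS w).1.
have [c1 l1 w1] := cong false; have [c2 l2 w2] := cong true.
(* At the face (0, 0) the two lines have opposite time orientations. *)
exists c1, c2; split=> // -[_ /(_ (0, 0)) [[a a0 dE] _]].
rewrite l1 l2 in dE; move/rowP/(_ 2): dE.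
rewrite /face_line /= /spin_dir /face_sign addTb addFb signrN.
rewrite !(vec3E, mxE).
have pos k :
    0 < (face_spinor s k (0, 0)).2 ^+ 2 + (face_spinor s k (0, 0)).1 ^+ 2.
  by rewrite lt_def spinor_neq0 addr_ge0 ?sqr_ge0.
move/eqP; rewrite mulrCA mulNr eq_sym -addr_eq0 -mulrDr mulf_eq0 signr_eq0 /=.
by rewrite gt_eqF // addr_gt0 ?mulr_gt0.
Qed.
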